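(* Let $H$ and $H'$ be finite simple graphs on vertex sets $[p]$ and $[q]$, respectively, and let $G=H*H'$ be the join of $H$ and $H'$. With $S=S_G$, $$\operatorname{Hilb}_{S/J_G}(t)=\operatorname{Hilb}_{S_H/J_H}(t)+\operatorname{Hilb}_{S_{H'}/J_{H'}}(t)+\frac{(p+q-1)t+1}{(1-t)^{p+q+1}}-\frac{(p-1)t+1}{(1-t)^{p+1}}-\frac{(q-1)t+1}{(1-t)^{q+1}}.$$
   Context: $K$ is a field; $p,q\ge1$. For a finite simple graph $\Gamma$ (with totally ordered vertex set), $S_\Gamma=K[x_v,y_v : v\in V(\Gamma)]$ (standard graded) and the binomial edge ideal of $\Gamma$ is $J_\Gamma=(x_iy_j-x_jy_i : \{i,j\}\in E(\Gamma),\ i<j)\subset S_\Gamma$. The join $H*H'$ is the graph with vertex set the disjoint union $[p]\sqcup[q]$ and edge set $E(H)\cup E(H')\cup\{\{i,j\} : i\in[p],\ j\in[q]\}$. $\operatorname{Hilb}_M(t)=\sum_{k\ge0}\dim_K(M_k)t^k$ is the Hilbert series. *)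

(* Defs.v *)
From HB Require Import structures.
From mathcomp Require Import all_boot all_order all_algebra.
From mathcomp Require Import boolp classical_sets.
From mathcomp.multinomials Require Import mpoly.

Set Implicit Arguments.
Unset Strict Implicit.
Unset Printing Implicit Defensive.

Import GRing.Theory.
Local Open Scope ring_scope.

(** * Formal power series

    [{fps R}] is R[[t]].  It is wrapped in a record because functions
    [nat -> R] already carry the pointwise ring structure. *)

Record fps (R : Type) := Fps { fcoef : nat -> R }.

Notation "{ 'fps' R }" := (fps R) (format "{ 'fps'  R }") : type_scope.

Lemma fpsP (R : Type) (f g : {fps R}) : (forall k, fcoef f k = fcoef g k) -> f = g.
Proof. by case: f g => [f] [g] /= /funext ->. Qed.

HB.instance Definition _ (R : Type) := gen_eqMixin {fps R}.
HB.instance Definition _ (R : Type) := gen_choiceMixin {fps R}.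

Section FpsRing.
Variable R : comUnitRingType.
Implicit Types f g h : {fps R}.

Definition fps_zero : {fps R} := Fps (fun=> 0).
Definition fps_opp f : {fps R} := Fps (fun k => - fcoef f k).
Definition fps_add f g : {fps R} := Fps (fun k => fcoef f k + fcoef g k).
Definition fps_one : {fps R} := Fps (fun k => (k == 0%N)%:R).
Definition fps_mul f g : {fps R} :=
  Fps (fun k => \sum_(i < k.+1) fcoef f i * fcoef g (k - i)%N).

Fact fps_addA : associative fps_add.
Proof. by move=> f g h; apply: fpsP => k /=; rewrite addrA. Qed.
Fact fps_addC : commutative fps_add.
Proof. by move=> f g; apply: fpsP => k /=; rewrite addrC. Qed.
Fact fps_add0 : left_id fps_zero fps_add.
Proof. by move=> f; apply: fpsP => k /=; rewrite add0r. Qed.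
Fact fps_addN : left_inverse fps_zero fps_opp fps_add.
Proof. by move=> f; apply: fpsP => k /=; rewrite addNr. Qed.

HB.instance Definition _ :=
  GRing.isZmodule.Build {fps R} fps_addA fps_addC fps_add0 fps_addN.

Let trunc n f : {poly R} := \poly_(i < n) fcoef f i.

Let coef_trunc n f i : (i < n)%N -> (trunc n f)`_i = fcoef f i.
Proof. by move=> lt_in; rewrite coef_poly lt_in. Qed.

Let fps_mulE n f g i :
  (i < n)%N -> fcoef (fps_mul f g) i = (trunc n f * trunc n g)`_i.
Proof.
move=> lt_in; rewrite coefM; apply: eq_bigr => j _.
rewrite !coef_trunc //; first exact: leq_ltn_trans (leq_subr _ _) lt_in.
by apply: leq_ltn_trans lt_in; rewrite -ltnS.
Qed.

Fact fps_mulC : commutative fps_mul.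
Proof.
by move=> f g; apply: fpsP => k; rewrite !(@fps_mulE k.+1) // mulrC.
Qed.

Fact fps_mulA : associative fps_mul.
Proof.
move=> f g h; apply: fpsP => k.
transitivity (trunc k.+1 f * (trunc k.+1 g * trunc k.+1 h))`_k.
  rewrite coefM; apply: eq_bigr => j _.
  by rewrite coef_trunc // (@fps_mulE k.+1) // ltnS leq_subr.
rewrite mulrA coefM; apply: eq_bigr => j _.
by rewrite coef_trunc ?ltnS ?leq_subr // (@fps_mulE k.+1).
Qed.

Fact fps_mul1 : left_id fps_one fps_mul.
Proof.
move=> f; apply: fpsP => k /=; rewrite big_ord_recl subn0 mul1r.
by rewrite big1 ?addr0 // => i _; rewrite mul0r.
Qed.

Fact fps_mulDl : left_distributive fps_mul fps_add.
Proof.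
move=> f g h; apply: fpsP => k /=; rewrite -big_split /=.
by apply: eq_bigr => i _; rewrite mulrDl.
Qed.

Fact fps_oner_neq0 : fps_one != 0.
Proof.
by apply/eqP => /(congr1 (fun f => fcoef f 0)) /= /eqP; rewrite oner_eq0.
Qed.

HB.instance Definition _ := GRing.Zmodule_isComNzRing.Build {fps R}
  fps_mulA fps_mulC fps_mul1 fps_mulDl fps_oner_neq0.

(** A series is invertible iff its constant term is.  The coefficients of the
    inverse are computed by the recursion a_0 = f_0^-1,
    a_k = - f_0^-1 * \sum_(i < k) f_(i+1) a_(k-1-i); as with [x^-1] in any
    [unitRingType], the inverse of a non-unit is that non-unit. *)
Fixpoint fps_inv_seq f (n : nat) : seq R :=
  if n is k.+1 then
    let s := fps_inv_seq f k in
    rcons s ((fcoef f 0)^-1 *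
             ((k == 0%N)%:R - \sum_(i < k) fcoef f i.+1 * s`_(k - i.+1)))
  else [::].

Definition fps_unit : {pred {fps R}} :=
  fun f => fcoef f 0 \is a GRing.unit.

Definition fps_inv f : {fps R} :=
  if f \in fps_unit then Fps (fun k => (fps_inv_seq f k.+1)`_k) else f.

Let size_fps_inv_seq f n : size (fps_inv_seq f n) = n.
Proof. by elim: n => //= n IHn; rewrite size_rcons IHn. Qed.

Let nth_fps_inv_seq f n k :
  (k < n)%N -> (fps_inv_seq f n)`_k = (fps_inv_seq f k.+1)`_k.
Proof.
elim: n => // n IHn; rewrite ltnS leq_eqVlt => /predU1P[-> //|lt_kn].
by rewrite -IHn //= nth_rcons size_fps_inv_seq lt_kn.
Qed.

Fact fps_mulV : {in fps_unit, left_inverse 1 fps_inv *%R}.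
Proof.
move=> f f_unit; rewrite mulrC; apply: fpsP => k.
rewrite /fps_inv f_unit [LHS]/= big_ord_recl subn0 /=.
rewrite nth_rcons size_fps_inv_seq ltnn eqxx mulVKr //.
rewrite -[RHS](subrK (\sum_(i < k) fcoef f i.+1 * (fps_inv_seq f k)`_(k - i.+1))).
congr (_ + _); apply: eq_bigr => i _; congr (_ * _).
have lt_ki: (k - i.+1 < k)%N by rewrite ltn_subrL /= (leq_ltn_trans _ (ltn_ord i)).
by rewrite [RHS]nth_fps_inv_seq.
Qed.

Fact fps_unitP f g : g * f = 1 -> f \in fps_unit.
Proof.
move=> /(congr1 (fun f => fcoef f 0)) /=; rewrite big_ord1 => gf1.
by apply/unitrPr; exists (fcoef g 0); rewrite mulrC.
Qed.

Fact fps_inv_out : {in [predC fps_unit], fps_inv =1 id}.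
Proof. by move=> f; rewrite inE /= /fps_inv => /negPf ->. Qed.

HB.instance Definition _ := GRing.ComNzRing_hasMulInverse.Build {fps R}
  fps_mulV fps_unitP fps_inv_out.

Definition fpsX : {fps R} := Fps (fun k => (k == 1%N)%:R).

End FpsRing.

Arguments fpsX {R}.

(** * Hilbert functions of graded quotients of polynomial rings *)

Definition ideal_gen (R : comNzRingType) (s : seq R) : {pred R} :=
  fun f => `[< exists c : 'I_(size s) -> R, f = \sum_(i < size s) c i * s`_i >].

Section Hilbert.
Variables (K : fieldType) (n : nat).
Implicit Types (I : {pred {mpoly K[n]}}) (k d : nat).

(** The residue classes of the [b i] form a K-basis of the degree [k]
    component of K[X_1..X_n] / I. *)
Definition quot_basis I k d (b : 'I_d -> {mpoly K[n]}) : Prop :=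
  [/\ forall i, b i \is k.-homog,
      forall f : {mpoly K[n]}, f \is k.-homog ->
        exists c : 'I_d -> K, f - \sum_i c i *: b i \in I
    & forall c : 'I_d -> K, \sum_i c i *: b i \in I -> forall i, c i = 0].

(** By [hilbert_functionE] and [hilbert_functionP] below, the default value 0
    is never used when [I] is an ideal. *)
Definition hilbert_function I k : nat :=
  xget 0%N [set d | exists b : 'I_d -> {mpoly K[n]}, quot_basis I k b]%classic.

Definition hilbert_series I : {fps int} :=
  Fps (fun k => (hilbert_function I k)%:Z).

Let quot_basis_leq I k d1 d2 (b1 : 'I_d1 -> {mpoly K[n]})
    (b2 : 'I_d2 -> {mpoly K[n]}) :
  submod_closed I -> quot_basis I k b1 -> quot_basis I k b2 -> (d1 <= d2)%N.
Proof.
move=> I_submod [hom1 gen1 free1] [hom2 gen2 _].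
have I0 : 0 \in I by case: I_submod.
have IZ a f : f \in I -> a *: f \in I.
  by move=> fI; rewrite -[_ *: f]addr0; apply: I_submod.2.
have ID f g : f \in I -> g \in I -> f + g \in I.
  by move=> fI gI; rewrite -[f]scale1r; apply: I_submod.2.
have IN f : f \in I -> - f \in I by rewrite -scaleN1r; apply: IZ.
have [A AP] := choice (fun i => gen2 _ (hom1 i)).
have [B BP] := choice (fun i => gen1 _ (hom2 i)).
pose MA := \matrix_(i, j) A i j; pose MB := \matrix_(i, j) B i j.
apply: (@mulmx1_min _ _ _ MA MB); apply/matrixP=> i l.
apply/eqP; rewrite -subr_eq0; apply/eqP; move: l.
apply: free1.
have -> : \sum_l ((MA *m MB) i l - 1%:M i l) *: b1 l =
   - (b1 i - \sum_j A i j *: b2 j)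
   - \sum_j A i j *: (b2 j - \sum_l B j l *: b1 l).
  have -> : \sum_j A i j *: (b2 j - \sum_l B j l *: b1 l) =
     \sum_j A i j *: b2 j - \sum_l (MA *m MB) i l *: b1 l.
    under eq_bigr do rewrite scalerBr scaler_sumr.
    rewrite sumrB exchange_big /=; congr (_ - _); apply: eq_bigr => l _.
    rewrite mxE scaler_suml; apply: eq_bigr => j _.
    by rewrite !mxE scalerA.
  under eq_bigr do rewrite scalerBl.
  rewrite sumrB !opprB.
  have -> : \sum_l (1%:M : 'M_d1) i l *: b1 l = b1 i.
    rewrite (bigD1 i) //= mxE eqxx scale1r big1 ?addr0 // => l /negPf nil.
    by rewrite mxE eq_sym nil scale0r.
  by rewrite [RHS]addrC addrA subrK.
apply: (ID) (IN _ (AP i)) (IN _ _).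
by apply: (big_ind (fun f => f \in I)) => [//|//|j _]; apply: IZ; apply: BP.
Qed.

Lemma hilbert_functionE I k d (b : 'I_d -> {mpoly K[n]}) :
  submod_closed I -> quot_basis I k b -> hilbert_function I k = d.
Proof.
move=> I_submod bP; apply/eqP; rewrite /hilbert_function.
case: xgetP => [_ -> [b' b'P] | /(_ d)[]]; last by exists b.
by rewrite eqn_leq !(quot_basis_leq I_submod b'P bP, quot_basis_leq I_submod bP b'P).
Qed.

Lemma hilbert_functionP I k : submod_closed I ->
  exists b : 'I_(hilbert_function I k) -> {mpoly K[n]}, quot_basis I k b.
Proof.
move=> I_submod.
suff [d [b bP]] : exists d (b : 'I_d -> {mpoly K[n]}), quot_basis I k b.
  by rewrite (hilbert_functionE I_submod bP); exists b.
have I0 : 0 \in I by case: I_submod.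
have IZ a f : f \in I -> a *: f \in I.
  by move=> fI; rewrite -[_ *: f]addr0; apply: I_submod.2.
have ID f g : f \in I -> g \in I -> f + g \in I.
  by move=> fI gI; rewrite -[f]scale1r; apply: I_submod.2.
have IN f : f \in I -> - f \in I by rewrite -scaleN1r; apply: IZ.
pose indep d (b : 'I_d -> {mpoly K[n]}) := (forall i, b i \is k.-homog) /\
  forall c : 'I_d -> K, \sum_i c i *: b i \in I -> forall i, c i = 0.
have ex : exists d, `[< exists b : 'I_d -> _, indep d b >].
  by exists 0%N; apply/asboolP; exists (fun=> 0); split=> [[]|c _ []].
have bnd d : `[< exists b : 'I_d -> _, indep d b >] -> (d <= #|{: 'X_{1..n < k.+1}}|)%N.
  move=> /asboolP[b [hom free]].
  pose M := \matrix_(i < d, j < #|{: 'X_{1..n < k.+1}}|) (b i)@_(enum_val j).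
  suff /eqP <- : row_free M by exact: rank_leq_col.
  rewrite -kermx_eq0; apply/rowV0P => v /sub_kermxP vM0.
  apply/rowP => i; rewrite mxE; apply: (free (fun i => v 0 i)).
  suff -> : \sum_i v 0 i *: b i = 0 by exact: I0.
  apply/mpolyP => m; rewrite mcoeff0 linear_sum /=.
  have [mk | mk] := eqVneq (mdeg m) k; last first.
    rewrite big1 // => j _; rewrite mcoeffZ.
    by rewrite (dhomog_nemf_coeff (hom j) mk) mulr0.
  have ltm : (mdeg m < k.+1)%N by rewrite mk.
  have /rowP/(_ (enum_rank (BMultinom ltm))) := vM0.
  rewrite !mxE => {2}<-; apply: eq_bigr => j _.
  by rewrite mcoeffZ mxE enum_rankK.
case: (ex_maxnP ex bnd) => d /asboolP[b [hom free]] maxd.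
exists d, b; split=> // f fk; apply: contrapT => nogen.
suff : (d.+1 <= d)%N by rewrite ltnn.
apply: maxd; apply/asboolP.
exists (fun i => if unlift ord0 i is Some j then b j else f); split.
  by move=> i; case: unliftP.
move=> c; rewrite big_ord_recl unlift_none.
under eq_bigr do rewrite liftK.
move=> cI.
have c0 : c ord0 = 0.
  apply/eqP/negPn/negP => c0; apply: nogen.
  exists (fun i => - (c ord0)^-1 * c (lift ord0 i)).
  have -> : f - \sum_i (- (c ord0)^-1 * c (lift ord0 i)) *: b i =
     (c ord0)^-1 *: (c ord0 *: f + \sum_i c (lift ord0 i) *: b i).
    rewrite scalerDr scalerA mulVf // scale1r scaler_sumr -sumrN.
    by congr (_ + _); apply: eq_bigr => i _; rewrite mulNr scaleNr opprK scalerA.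
  exact: IZ.
move: cI; rewrite c0 scale0r add0r => cI i.
by case: (unliftP ord0 i) => [j ->|->//]; apply: (free (fun i => c (lift ord0 i))).
Qed.

End Hilbert.

Lemma ideal_gen_submod (K : fieldType) n (s : seq {mpoly K[n]}) :
  submod_closed (ideal_gen s).
Proof.
split; first by apply/asboolP; exists (fun=> 0); rewrite big1 // => i; rewrite mul0r.
move=> a f g /asboolP[c ->] /asboolP[c' ->]; apply/asboolP.
exists (fun i => a *: c i + c' i); rewrite scaler_sumr -big_split /=.
by apply: eq_bigr => i _; rewrite mulrDl scalerAl.
Qed.

(** * Graphs and binomial edge ideals *)

Record sgraph (n : nat) := SGraph {
  edge :> rel 'I_n;
  edge_sym : ssrbool.symmetric edge;
  edge_irrefl : irreflexive edge
}.

(** The disjoint union of [p] and [q] is 'I_(p + q), via [split]. *)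
Section Join.
Variables (p q : nat) (H : sgraph p) (H' : sgraph q).

Definition join_edge : rel 'I_(p + q) := fun u v =>
  match split u, split v with
  | inl i, inl j => H i j
  | inr i, inr j => H' i j
  | _, _ => true
  end.

Fact join_edge_sym : ssrbool.symmetric join_edge.
Proof.
by move=> u v; rewrite /join_edge; case: (split u) (split v) => [i|i] [j|j] //;
   apply: edge_sym.
Qed.

Fact join_edge_irrefl : irreflexive join_edge.
Proof.
by move=> u; rewrite /join_edge; case: (split u) => i; apply: edge_irrefl.
Qed.

Definition graph_join : sgraph (p + q) := SGraph join_edge_sym join_edge_irrefl.

End Join.

Section BinomialEdgeIdeal.
Variables (K : fieldType) (n : nat).

(** The 2n variables of S_G: x_1, ..., x_n, y_1, ..., y_n. *)
Definition varx (i : 'I_n) : {mpoly K[n + n]} := 'X_(lshift n i).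
Definition vary (i : 'I_n) : {mpoly K[n + n]} := 'X_(rshift n i).

Definition edge_binomials (G : sgraph n) : seq {mpoly K[n + n]} :=
  [seq varx e.1 * vary e.2 - varx e.2 * vary e.1
     | e : 'I_n * 'I_n in [pred e : 'I_n * 'I_n | (e.1 < e.2)%N && G e.1 e.2]].

Definition binomial_edge_ideal (G : sgraph n) : {pred {mpoly K[n + n]}} :=
  ideal_gen (edge_binomials G).

End BinomialEdgeIdeal.

Arguments varx K {n} i.
Arguments vary K {n} i.
Arguments edge_binomials K {n} G.
Arguments binomial_edge_ideal K {n} G.

(* Main.v *)
(** Let K_n be the complete graph.  Since J_G is contained in J_(K_(p+q)), the
    Hilbert function of S/J_G is that of S/J_(K_(p+q)) plus that of
    J_(K_(p+q))/J_G, and similarly for H and H'.  Writing f_uv for the binomial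
    x_u y_v - x_v y_u, the Pluecker relation x_w f_uv = x_u f_wv - x_v f_wu (and
    its analogue for y_w) shows that f_uv with u, v in [p] is annihilated modulo
    J_G by the variables of every w in [q].  Hence J_(K_(p+q))/J_G is the direct
    sum of J_(K_p)/J_H and J_(K_q)/J_H', the projections being induced by
    setting the variables of the other side to 0.  Finally S/J_(K_n) is the
    coordinate ring of the Segre variety P^1 x P^(n-1), of Hilbert function
    (k+1) C(n+k-1, k). *)
From HB Require Import structures.
Require Import Defs.
From mathcomp Require Import all_boot all_order all_algebra.
From mathcomp Require Import boolp ring zify.
From mathcomp.multinomials Require Import mpoly.

Import GRing.Theory.
Local Open Scope ring_scope.

Set Implicit Arguments.
Unset Strict Implicit.
Unset Printing Implicit Defensive.

(** * Bases of subquotients *)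

Section BasisMod.
Variables (K : fieldType) (V : lmodType K).
Implicit Types (T : finType) (U W : {pred V}).

(** The residue classes of the [b i] form a K-basis of U / (U :&: W). *)
Definition basis_mod T U W (b : T -> V) : Prop :=
  [/\ forall i, b i \in U,
      forall f, f \in U -> exists c : T -> K, f - \sum_i c i *: b i \in W
    & forall c : T -> K, \sum_i c i *: b i \in W -> forall i, c i = 0].

Section Submod.
Variable W : {pred V}.
Hypothesis W_submod : submod_closed W.

Lemma submod0 : 0 \in W. Proof. by case: W_submod. Qed.

Lemma submodZ a f : f \in W -> a *: f \in W.
Proof. by move=> fW; rewrite -[_ *: f]addr0; apply: (W_submod.2) submod0. Qed.

Lemma submodD f g : f \in W -> g \in W -> f + g \in W.
Proof. by move=> fW gW; rewrite -[f]scale1r; apply: (W_submod.2). Qed.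

Lemma submodN f : f \in W -> - f \in W.
Proof. by move=> fW; rewrite -scaleN1r; exact: submodZ. Qed.

Lemma submodB f g : f \in W -> g \in W -> f - g \in W.
Proof. by move=> fW gW; exact: submodD (submodN gW). Qed.

Lemma submod_sum (I : Type) (r : seq I) (P : pred I) (F : I -> V) :
  (forall i, P i -> F i \in W) -> \sum_(i <- r | P i) F i \in W.
Proof.
by move=> FW; apply: (big_ind (fun f => f \in W)) FW; [exact: submod0 | exact: submodD].
Qed.

Lemma submod_lin (T : finType) (c : T -> K) (F : T -> V) :
  (forall i, F i \in W) -> \sum_i c i *: F i \in W.
Proof. by move=> FW; apply: submod_sum => i _; apply: submodZ. Qed.

(** Expand the [e i] along [b] modulo W. A row vector killing the coefficient matrix gives a
    combination of the [e i] lying in W, hence is 0, so the rows are independent and their number is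
    at most the number of columns. *)
Lemma free_mod_leq T U (b : T -> V) d (e : 'I_d -> V) :
    basis_mod U W b -> (forall i, e i \in U) ->
    (forall c : 'I_d -> K, \sum_i c i *: e i \in W -> forall i, c i = 0) ->
  (d <= #|T|)%N.
Proof.
move=> [_ gen _] eU free.
have [A AP] := choice (fun i => gen _ (eU i)).
pose M := \matrix_(i < d, j < #|T|) A i (enum_val j).
suff /eqP <- : row_free M by exact: rank_leq_col.
rewrite -kermx_eq0; apply/rowV0P => v /sub_kermxP vM0.
apply/rowP => i; rewrite mxE; apply: (free (fun i => v 0 i)).
(* Since [v] kills the coefficient matrix, the subtracted combination of the [b j] is 0, and what
   remains is a combination of elements of W. *)
have -> : \sum_i v 0 i *: e i =
    \sum_i v 0 i *: (e i - \sum_j A i j *: b j).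
  under [RHS]eq_bigr do rewrite scalerBr scaler_sumr.
  rewrite sumrB exchange_big /= [X in _ - X]big1 ?subr0 // => j _.
  under eq_bigr do rewrite scalerA.
  rewrite -scaler_suml.
  have /rowP/(_ (enum_rank j)) := vM0; rewrite !mxE.
  by under eq_bigr do rewrite mxE enum_rankK; move->; rewrite scale0r.
exact: submod_lin.
Qed.

(** Families in U' that are independent modulo W have bounded length by [free_mod_leq]; one of
    maximal length also spans. *)
Lemma basis_mod_sub T U U' (b : T -> V) :
    basis_mod U W b -> submod_closed U' -> {subset U' <= U} ->
  exists d (e : 'I_d -> V), basis_mod U' W e.
Proof.
move=> bP U'_submod U'U.
pose indep d (e : 'I_d -> V) := (forall i, e i \in U') /\
  forall c : 'I_d -> K, \sum_i c i *: e i \in W -> forall i, c i = 0.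
have ex : exists d, `[< exists e : 'I_d -> V, indep d e >].
  by exists 0%N; apply/asboolP; exists (fun=> 0); split=> [[]|c _ []].
have bnd d : `[< exists e : 'I_d -> V, indep d e >] -> (d <= #|T|)%N.
  move=> /asboolP[e [eU' free]].
  by apply: (free_mod_leq bP _ free) => i; apply/U'U/eU'.
case: (ex_maxnP ex bnd) => d /asboolP[e [eU' free]] maxd.
exists d, e; split=> // f fU'; apply: contrapT => nogen.
suff : (d.+1 <= d)%N by rewrite ltnn.
apply: maxd; apply/asboolP.
exists (fun i => if unlift ord0 i is Some j then e j else f); split.
  by move=> i; case: unliftP.
move=> c; rewrite big_ord_recl unlift_none.
under eq_bigr do rewrite liftK.
move=> cW.
(* A nonzero coefficient of [f] could be divided out, expressing [f] through [e] modulo W against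
   [nogen]. *)
have c0 : c ord0 = 0.
  apply/eqP/negPn/negP => c0; apply: nogen.
  exists (fun i => - (c ord0)^-1 * c (lift ord0 i)).
  have -> : f - \sum_i (- (c ord0)^-1 * c (lift ord0 i)) *: e i =
     (c ord0)^-1 *: (c ord0 *: f + \sum_i c (lift ord0 i) *: e i).
    rewrite scalerDr scalerA mulVf // scale1r scaler_sumr -sumrN.
    by congr (_ + _); apply: eq_bigr => i _; rewrite mulNr scaleNr opprK scalerA.
  exact: submodZ.
move: cW; rewrite c0 scale0r add0r => cW i.
by case: (unliftP ord0 i) => [j ->|->//]; apply: (free (fun i => c (lift ord0 i))).
Qed.

End Submod.

Lemma predI_submod U W :
  submod_closed U -> submod_closed W -> submod_closed [predI U & W].
Proof.
move=> U_submod W_submod; split; first by rewrite inE !submod0.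
move=> a f g; rewrite !inE => /andP[fU fW] /andP[gU gW].
by rewrite !(U_submod.2, W_submod.2).
Qed.

(** Exactness of 0 -> (U ∩ J)/(U ∩ W) -> U/(U ∩ W) -> U/(U ∩ J) -> 0 in terms of bases; this makes
    dimensions additive. *)
Lemma basis_mod_cat T1 T2 U W J (b1 : T1 -> V) (b2 : T2 -> V) :
    submod_closed U -> submod_closed J -> {subset W <= J} ->
    basis_mod [predI U & J] W b1 -> basis_mod U J b2 ->
  basis_mod U W (fun i => match i with inl j => b1 j | inr j => b2 j end).
Proof.
move=> U_submod J_submod WJ [b1UJ gen1 free1] [b2U gen2 free2]; split.
- by case=> i //; have /andP[] := b1UJ i.
- move=> f fU; have [c2 fJ] := gen2 f fU.
  have [|c1 fW] := gen1 (f - \sum_i c2 i *: b2 i).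
    by rewrite inE fJ (submodB U_submod) // submod_lin.
  exists (fun i => match i with inl j => c1 j | inr j => c2 j end).
  by rewrite big_sumType /= [X in f - X]addrC opprD addrA.
move=> c; rewrite big_sumType /= => cW.
(* W and all [b1 i] lie in J, so modulo J the relation only involves [b2]. *)
have c20 : forall i, c (inr i) = 0.
  apply: free2; rewrite -[X in X \in _](addKr (\sum_i c (inl i) *: b1 i)).
  apply: (submodD J_submod) (WJ _ cW).
  by apply/(submodN J_submod)/submod_lin => // i; have /andP[] := b1UJ i.
have c10 : forall i, c (inl i) = 0.
  apply: free1; move: cW; rewrite [X in _ + X]big1 ?addr0 // => i _.
  by rewrite c20 scale0r.
by case.
Qed.

Lemma basis_mod_enum T U W (b : T -> V) :
  basis_mod U W b -> basis_mod U W (b \o @enum_val T predT).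
Proof.
move=> [bU gen free]; split; first by move=> i; apply: bU.
  move=> f /gen[c fW]; exists (c \o enum_val).
  by rewrite (reindex _ (onW_bij _ (@enum_val_bij T))) /= in fW.
move=> c cW i.
suff /(_ (enum_val i)) : forall x, c (enum_rank x) = 0 by rewrite enum_valK.
apply: free; rewrite (reindex _ (onW_bij _ (@enum_val_bij T))) /=.
by under eq_bigr do rewrite enum_valK.
Qed.

End BasisMod.

Arguments basis_mod {K V T} U W b.

(** The two long hypotheses say that [phi1] and [phi2] induce a surjective and injective map from
    the direct sum of U1/W1 and U2/W2 to U/W, so the images of the two bases together form a
    basis. *)
Lemma basis_mod_sum (K : fieldType) (V V1 V2 : lmodType K)
    (T1 T2 : finType) (U W : {pred V}) (U1 W1 : {pred V1}) (U2 W2 : {pred V2})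
    (phi1 : {linear V1 -> V}) (phi2 : {linear V2 -> V})
    (b1 : T1 -> V1) (b2 : T2 -> V2) :
    submod_closed W -> submod_closed U1 -> submod_closed U2 ->
    {homo phi1 : f / f \in W1 >-> f \in W} ->
    {homo phi2 : f / f \in W2 >-> f \in W} ->
    {homo phi1 : f / f \in U1 >-> f \in U} ->
    {homo phi2 : f / f \in U2 >-> f \in U} ->
    (forall f, f \in U -> exists f1 f2,
       [/\ f1 \in U1, f2 \in U2 & f - phi1 f1 - phi2 f2 \in W]) ->
    (forall f1 f2, f1 \in U1 -> f2 \in U2 -> phi1 f1 + phi2 f2 \in W ->
       f1 \in W1 /\ f2 \in W2) ->
    basis_mod U1 W1 b1 -> basis_mod U2 W2 b2 ->
  basis_mod U W (fun i => match i with inl j => phi1 (b1 j) | inr j => phi2 (b2 j) end).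
Proof.
move=> W_submod U1_submod U2_submod hW1 hW2 hU1 hU2 dec inj.
move=> [b1U gen1 free1] [b2U gen2 free2].
have lin1 c : phi1 (\sum_i c i *: b1 i) = \sum_i c i *: phi1 (b1 i).
  by rewrite linear_sum; apply: eq_bigr => i _; rewrite linearZ.
have lin2 c : phi2 (\sum_i c i *: b2 i) = \sum_i c i *: phi2 (b2 i).
  by rewrite linear_sum; apply: eq_bigr => i _; rewrite linearZ.
split.
- by case=> i; [exact/hU1/b1U | exact/hU2/b2U].
- move=> f /dec[f1 [f2 [/gen1[c1 f1W] /gen2[c2 f2W] fW]]].
  exists (fun i => match i with inl j => c1 j | inr j => c2 j end).
  rewrite big_sumType /= -lin1 -lin2.
  move: (submodD W_submod (submodD W_submod fW (hW1 _ f1W)) (hW2 _ f2W)).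
  rewrite !linearB /= opprD.
  rewrite [f - _ - _]addrAC [_ + (phi1 f1 - _)]addrA subrK.
  by rewrite addrAC [_ + (phi2 f2 - _)]addrA subrK -!addrA.
move=> c; rewrite big_sumType /= -lin1 -lin2 => cW.
have [cW1 cW2] := inj _ _ (submod_lin U1_submod _ b1U) (submod_lin U2_submod _ b2U) cW.
by case=> i; [apply: (free1 (c \o inl) cW1) | apply: (free2 (c \o inr) cW2)].
Qed.

(** * Hilbert functions and binomial series *)

Definition degree_part (n : nat) (R : nzRingType) k : {pred {mpoly R[n]}} :=
  fun f => f \is k.-homog.

Lemma degree_part_submod (n : nat) (K : fieldType) k : submod_closed (@degree_part n K k).
Proof. exact: dhomog_submod_closed. Qed.

Lemma hilbert_function_basis (K : fieldType) n (I : {pred {mpoly K[n]}}) k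
    (T : finType) (b : T -> {mpoly K[n]}) :
  submod_closed I -> basis_mod (degree_part k) I b -> hilbert_function I k = #|T|.
Proof.
by move=> I_submod /basis_mod_enum bP; apply: (hilbert_functionE I_submod bP).
Qed.

(** Multiplication by 1 - t is the backward difference on coefficients. *)
Lemma coef_subX (f : {fps int}) k :
  fcoef (f * (1 - fpsX)) k = fcoef f k - (if k is j.+1 then fcoef f j else 0).
Proof.
have -> : f * (1 - fpsX) = f - f * fpsX by ring.
rewrite /=; congr (_ - _).
case: k => [|k]; first by rewrite big_ord1 mulr0.
rewrite big_ord_recr /= subnn mulr0 addr0 big_ord_recr /= subSnn mulr1.
rewrite big1 ?add0r // => -[i /= lt_ik] _.
have -> : (k.+1 - i == 1)%N = false.
  by rewrite subSn ?(ltnW lt_ik) // eqSS subn_eq0 leqNgt lt_ik.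
by rewrite mulr0.
Qed.

Definition bin_series n : {fps int} := Fps (fun k => 'C(n + k, k)%:Z).

(** By Pascal's rule the backward difference of [bin_series n.+1] is [bin_series n]. *)
Lemma bin_seriesM n : bin_series n * (1 - fpsX) ^+ n.+1 = 1.
Proof.
elim: n => [|n IHn].
  apply: fpsP => k; rewrite expr1 coef_subX /= add0n binn.
  by case: k => [|k]; rewrite /= ?add0n ?binn ?subr0 ?subrr.
suff -> : bin_series n.+1 * (1 - fpsX) ^+ n.+2 = bin_series n * (1 - fpsX) ^+ n.+1 by [].
rewrite [_ ^+ n.+2]exprS mulrA; congr (_ * _).
apply: fpsP => k; rewrite coef_subX /=; case: k => [|k]; first by rewrite !bin0 subr0.
rewrite addSn binS !addnS addSn PoszD; ring.
Qed.

(** Hilbert series of the Segre variety P^1 x P^n, which belongs to the complete graph on n + 1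
    vertices. *)
Definition segre_series n : {fps int} := Fps (fun k => (k.+1 * 'C(k + n, k))%:Z).

Lemma segre_seriesE n :
  segre_series n = (((n.+1)%:R - 1) * fpsX + 1) / (1 - fpsX) ^+ (n.+1 + 1).
Proof.
have u : (1 - fpsX : {fps int}) ^+ (n.+1 + 1) \is a GRing.unit.
  by apply/unitrPr; exists (bin_series n.+1); rewrite mulrC addn1 bin_seriesM.
apply: (mulIr u); rewrite divrK //.
(* This splits the fraction into 1/(1-t)^(n+1) + (n+1)t/(1-t)^(n+2), both terms being known binomial
   series. *)
have -> : (n.+1%:R - 1) * fpsX + 1 = (1 - fpsX) + n.+1%:R * fpsX :> {fps int} by ring.
rewrite addn1.
suff -> : segre_series n = bin_series n + n.+1%:R * (fpsX * bin_series n.+1).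
  transitivity (bin_series n * (1 - fpsX) ^+ n.+1 * (1 - fpsX)
      + n.+1%:R * fpsX * (bin_series n.+1 * (1 - fpsX) ^+ n.+2)).
    by rewrite [_ ^+ n.+2]exprS; ring.
  by rewrite !bin_seriesM; ring.
apply: fpsP => k.
have coef_natM m (f : {fps int}) j : fcoef (m%:R * f) j = m%:R * fcoef f j.
  elim: m => [|m IHm]; first by rewrite !mul0r.
  by rewrite ![m.+1%:R]mulrSr !mulrDl !mul1r -IHm.
(* In this form the shift by t is computed by [coef_subX]. *)
have -> : fpsX * bin_series n.+1 = bin_series n.+1 - bin_series n.+1 * (1 - fpsX).
  by ring.
have -> : fcoef (bin_series n + n.+1%:R * (bin_series n.+1 - bin_series n.+1 * (1 - fpsX))) k
   = fcoef (bin_series n) k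
     + n.+1%:R * (fcoef (bin_series n.+1) k - fcoef (bin_series n.+1 * (1 - fpsX)) k).
  exact: (congr1 (+%R _) (coef_natM _ _ _)).
rewrite coef_subX subKr /=.
case: k => [|k]; first by rewrite !bin0 mulr0.
have : (k.+1 * 'C(k.+1 + n, k.+1) = n.+1 * 'C(n.+1 + k, k))%N.
  by rewrite mul_bin_left addSnnS addnC addnK.
by rewrite [(k.+2 * _)%N]mulSnr => ->; rewrite PoszD PoszM -natz addrC [(n + _)%N]addnC natz.
Qed.

(** * Binomial edge ideals and vertex substitutions *)

Section IdealGen.
Variables (R : comNzRingType) (s : seq R).

Lemma ideal_gen_mem g : g \in s -> g \in ideal_gen s.
Proof.
move=> gs; apply/asboolP.
have lt_g : (index g s < size s)%N by rewrite index_mem.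
exists (fun i => (i == Ordinal lt_g)%:R).
rewrite (bigD1 (Ordinal lt_g)) //= eqxx mul1r nth_index // big1 ?addr0 // => i.
by move/negPf->; rewrite mul0r.
Qed.

Lemma ideal_genM a f : f \in ideal_gen s -> a * f \in ideal_gen s.
Proof.
move=> /asboolP[c ->]; apply/asboolP; exists (fun i => a * c i).
by rewrite mulr_sumr; apply: eq_bigr => i _; rewrite mulrA.
Qed.

Lemma ideal_gen_ind (P : R -> Prop) :
    P 0 -> (forall f g, P f -> P g -> P (f + g)) ->
    (forall c g, g \in s -> P (c * g)) ->
  forall f, f \in ideal_gen s -> P f.
Proof.
move=> P0 PD Pg f /asboolP[c ->]; apply: big_ind => // i _.
exact/Pg/mem_nth.
Qed.

End IdealGen.

Lemma mpoly_alg_ind (R : comNzRingType) n (P : {mpoly R[n]} -> Prop) :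
    (forall c, P c%:MP) -> (forall f g, P f -> P g -> P (f + g)) ->
    (forall i f, P f -> P ('X_i * f)) ->
  forall f, P f.
Proof.
move=> PC PD PX; elim/mpolyind => [|c m f _ _ Pf]; first by rewrite -mpolyC0.
apply: PD => //; rewrite mpolyXE_id -mul_mpolyC mulrC.
elim/big_rec: _ => [|i g _ Pg]; first by rewrite mul1r.
rewrite -mulrA; elim: (m i) => [|k IHk]; first by rewrite mul1r.
by rewrite exprS -mulrA; apply: PX.
Qed.

Section BEI.
Variable K : fieldType.

Definition binom n (u v : 'I_n) : {mpoly K[n + n]} :=
  varx K u * vary K v - varx K v * vary K u.

Lemma binomC n (u v : 'I_n) : binom u v = - binom v u.
Proof. by rewrite /binom; ring. Qed.

Lemma bei_submod n (G : sgraph n) : submod_closed (binomial_edge_ideal K G).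
Proof. exact: ideal_gen_submod. Qed.

(** The generators are listed only for u < v; antisymmetry of [binom] gives the other
    orientation. *)
Lemma bei_binom n (G : sgraph n) u v : G u v -> binom u v \in binomial_edge_ideal K G.
Proof.
wlog lt_uv : u v / (u < v)%N => [wlg|Guv].
  case: (ltngtP u v) => [|lt_vu Guv|/val_inj->]; first exact: wlg.
    rewrite binomC; apply: (submodN (@bei_submod _ G)); apply: wlg => //.
    by rewrite edge_sym.
  by rewrite edge_irrefl.
apply: ideal_gen_mem; apply/imageP; exists (u, v) => //.
by rewrite inE lt_uv.
Qed.

Lemma bei_ind n (G : sgraph n) (P : {mpoly K[n + n]} -> Prop) :
    P 0 -> (forall f g, P f -> P g -> P (f + g)) ->
    (forall c u v, G u v -> P (c * binom u v)) ->
  forall f, f \in binomial_edge_ideal K G -> P f.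
Proof.
move=> P0 PD Pg; apply: ideal_gen_ind => // c g /imageP[[u v]].
by rewrite inE => /andP[_ Guv] ->; apply: Pg.
Qed.

Definition subst_tuple n m (s : 'I_n -> option 'I_m) :=
  [tuple match split w with
         | inl u => oapp (varx K) 0 (s u)
         | inr u => oapp (vary K) 0 (s u)
         end | w < n + n].

(** Sends x_u, y_u to x_(s u), y_(s u), or to 0 where [s u = None]. *)
Definition vsubst n m (s : 'I_n -> option 'I_m) : {mpoly K[n + n]} -> {mpoly K[m + m]} :=
  comp_mpoly (subst_tuple s).

HB.instance Definition _ n m (s : 'I_n -> option 'I_m) := GRing.RMorphism.on (vsubst s).
HB.instance Definition _ n m (s : 'I_n -> option 'I_m) := GRing.Linear.on (vsubst s).

Lemma vsubst_x n m (s : 'I_n -> option 'I_m) u :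
  vsubst s (varx K u) = oapp (varx K) 0 (s u).
Proof.
by rewrite /vsubst comp_mpolyXU -tnth_nth tnth_mktuple (unsplitK (inl u)).
Qed.

Lemma vsubst_y n m (s : 'I_n -> option 'I_m) u :
  vsubst s (vary K u) = oapp (vary K) 0 (s u).
Proof.
by rewrite /vsubst comp_mpolyXU -tnth_nth tnth_mktuple (unsplitK (inr u)).
Qed.

Lemma vsubst_binom n m (s : 'I_n -> option 'I_m) u v :
  vsubst s (binom u v) =
    if (s u, s v) is (Some i, Some j) then binom i j else 0.
Proof.
rewrite rmorphB !rmorphM /= !vsubst_x !vsubst_y.
by case: (s u) (s v) => [i|] [j|] //=; rewrite ?mul0r ?mulr0 subrr.
Qed.

Lemma vsubstC n m (s : 'I_n -> option 'I_m) c : vsubst s c%:MP = c%:MP.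
Proof. exact: comp_mpolyC. Qed.

Lemma var_ind n (P : {mpoly K[n + n]} -> Prop) :
    (forall c, P c%:MP) -> (forall f g, P f -> P g -> P (f + g)) ->
    (forall u f, P f -> P (varx K u * f)) ->
    (forall u f, P f -> P (vary K u * f)) ->
  forall f, P f.
Proof.
move=> PC PD Px Py; apply: mpoly_alg_ind => // w f.
by rewrite -(splitK w); case: (split w) => u; [apply: Px | apply: Py].
Qed.

(** Each generator f_uv goes to the generator f_ij of an edge of G', or to 0 if an endpoint is
    deleted. *)
Lemma vsubst_bei n m (G : sgraph n) (G' : sgraph m) (s : 'I_n -> option 'I_m) :
    (forall u v i j, s u = Some i -> s v = Some j -> G u v -> G' i j) ->
  {homo vsubst s : f / f \in binomial_edge_ideal K G >-> f \in binomial_edge_ideal K G'}.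
Proof.
move=> hs; apply: bei_ind => [|f g|c u v Guv].
- rewrite rmorph0; exact: submod0 (@bei_submod _ _).
- rewrite rmorphD; exact: (submodD (@bei_submod _ G')).
rewrite rmorphM; apply: ideal_genM; rewrite /= vsubst_binom.
case su: (s u) => [i|]; last exact: submod0 (@bei_submod _ _).
case sv: (s v) => [j|]; last exact: submod0 (@bei_submod _ _).
exact/bei_binom/(hs _ _ _ _ su sv).
Qed.

(** Every variable is sent to a variable or to 0, and 0 is homogeneous of every degree. *)
Lemma vsubst_degree_part n m (s : 'I_n -> option 'I_m) k :
  {homo vsubst s : f / f \in degree_part k >-> f \in degree_part k}.
Proof.
move=> f fk; rewrite /vsubst comp_mpolyEX big_seq.
apply: (submod_sum (@degree_part_submod _ _ _)) => mo mo_f.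
apply: (submodZ (@degree_part_submod _ _ _)).
have <- : mdeg mo = k := dhomog_mf fk mo_f.
rewrite mdegE comp_mpolyX unfold_in.
elim: (index_enum _) => [|w r IHr]; first by rewrite !big_nil dhomog1.
rewrite !big_cons; apply: dhomogM IHr.
rewrite -[X in X.-homog]mul1n; apply: dhomogMn; rewrite tnth_mktuple.
by case: (split w) => u; case: (s u) => [i|] /=; rewrite ?dhomog0 // dhomogX;
  apply/eqP; apply: mdeg1.
Qed.

Lemma vsubstK n m (s : 'I_n -> option 'I_m) (r : 'I_m -> option 'I_n) :
  (forall u, obind r (s u) = Some u) -> cancel (vsubst s) (vsubst r).
Proof.
move=> rs; apply: var_ind => [c|f g Ef Eg|u f Ef|u f Ef].
- by rewrite !vsubstC.
- by rewrite !rmorphD /= Ef Eg.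
- rewrite !rmorphM /= Ef vsubst_x; case: (s u) (rs u) => //= i ri.
  by rewrite vsubst_x ri.
- rewrite !rmorphM /= Ef vsubst_y; case: (s u) (rs u) => //= i ri.
  by rewrite vsubst_y ri.
Qed.

End BEI.

(** * The join *)

Section Complete.
Variable n : nat.

Definition complete_edge : rel 'I_n := fun u v => u != v.

Fact complete_edge_sym : ssrbool.symmetric complete_edge.
Proof. by move=> u v; rewrite /complete_edge eq_sym. Qed.

Fact complete_edge_irrefl : irreflexive complete_edge.
Proof. by move=> u; rewrite /complete_edge eqxx. Qed.

Definition complete_graph : sgraph n := SGraph complete_edge_sym complete_edge_irrefl.
End Complete.

Section Join.
Variable K : fieldType.

Lemma bei_complete n (G : sgraph n) :
  {subset binomial_edge_ideal K G <= binomial_edge_ideal K (complete_graph n)}.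
Proof.
apply: bei_ind => [|f g|c u v Guv]; first exact: submod0 (@bei_submod _ _ _).
  exact: (submodD (@bei_submod _ _ _)).
apply/ideal_genM/bei_binom; rewrite /= /complete_edge.
by apply: contraTneq Guv => ->; rewrite edge_irrefl.
Qed.

(** Here [s] includes one side of a join and [r] is its partial inverse. Modulo J_G, the product of
    [f] with a binomial of that side is unchanged when the variables of all other vertices are set
    to 0 in [f]. The induction peels off one variable of [f] at a time. *)
Lemma bei_cone m n (G : sgraph n) (s : 'I_m -> 'I_n) (r : 'I_n -> option 'I_m) :
    (forall w i, r w = Some i -> s i = w) ->
    (forall w i, r w = None -> G w (s i)) ->
  forall i j f, (f - vsubst (Some \o s) (vsubst r f)) * binom K (s i) (s j)
    \in binomial_edge_ideal K G.
Proof.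
move=> rP Gr i j; have I_submod := @bei_submod K _ G.
apply: var_ind => [c|f g|w f|w f].
- by rewrite !vsubstC subrr mul0r; apply: submod0.
- move=> fI gI; rewrite !rmorphD /= opprD addrACA mulrDl.
  exact: (submodD I_submod).
- rewrite !rmorphM /= vsubst_x; case rw: (r w) => [a|] /=.
    by rewrite vsubst_x /= (rP _ _ rw) -mulrBr -mulrA => /ideal_genM; apply.
  move=> _; rewrite rmorph0 mul0r subr0.
  (* The vertex [w] is off the side, so its variable is substituted by 0 and the whole product must
     lie in J_G; the Pluecker relation writes it through edges at [w]. *)
  have -> : varx K w * f * binom K (s i) (s j) =
      f * varx K (s i) * binom K w (s j) - f * varx K (s j) * binom K w (s i).
    by rewrite /binom; ring.
  by apply: (submodB I_submod); apply/ideal_genM/bei_binom/Gr.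
- rewrite !rmorphM /= vsubst_y; case rw: (r w) => [a|] /=.
    by rewrite vsubst_y /= (rP _ _ rw) -mulrBr -mulrA => /ideal_genM; apply.
  move=> _; rewrite rmorph0 mul0r subr0.
  have -> : vary K w * f * binom K (s i) (s j) =
      f * vary K (s i) * binom K w (s j) - f * vary K (s j) * binom K w (s i).
    by rewrite /binom; ring.
  by apply: (submodB I_submod); apply/ideal_genM/bei_binom/Gr.
Qed.

Variables (p q : nat) (H : sgraph p) (H' : sgraph q).
Let G := graph_join H H'.

(** [phi1], [phi2] are the inclusions of the polynomial rings of the two sides; [rho1], [rho2] are
    their retractions, setting the variables of the other side to 0. *)
Local Notation phi1 := (@vsubst K _ _ (Some \o @lshift p q)).
Local Notation phi2 := (@vsubst K _ _ (Some \o @rshift p q)).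
Let left_vertex (w : 'I_(p + q)) := if split w is inl i then Some i else None.
Let right_vertex (w : 'I_(p + q)) := if split w is inr i then Some i else None.
Local Notation rho1 := (@vsubst K _ _ left_vertex).
Local Notation rho2 := (@vsubst K _ _ right_vertex).

Let split_lshift i : split (lshift q i) = inl i :> 'I_p + 'I_q.
Proof. exact: (unsplitK (inl i)). Qed.
Let split_rshift i : split (rshift p i) = inr i :> 'I_p + 'I_q.
Proof. exact: (unsplitK (inr i)). Qed.

Let phi1_bei :
  {homo phi1 : f / f \in binomial_edge_ideal K H >-> f \in binomial_edge_ideal K G}.
Proof.
by apply: vsubst_bei => u v _ _ [<-] [<-]; rewrite /= /join_edge !split_lshift.
Qed.

Let phi2_bei :
  {homo phi2 : f / f \in binomial_edge_ideal K H' >-> f \in binomial_edge_ideal K G}.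
Proof.
by apply: vsubst_bei => u v _ _ [<-] [<-]; rewrite /= /join_edge !split_rshift.
Qed.

Let rho1_bei :
  {homo rho1 : f / f \in binomial_edge_ideal K G >-> f \in binomial_edge_ideal K H}.
Proof.
apply: vsubst_bei => u v i j; rewrite /= /join_edge /left_vertex.
by case: (split u) (split v) => [a|a] [b|b] //= [->] [->].
Qed.

Let rho2_bei :
  {homo rho2 : f / f \in binomial_edge_ideal K G >-> f \in binomial_edge_ideal K H'}.
Proof.
apply: vsubst_bei => u v i j; rewrite /= /join_edge /right_vertex.
by case: (split u) (split v) => [a|a] [b|b] //= [->] [->].
Qed.
Let phi1K : cancel phi1 rho1.
Proof. by apply: vsubstK => u; rewrite /= /left_vertex split_lshift. Qed.

Let phi2K : cancel phi2 rho2.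
Proof. by apply: vsubstK => u; rewrite /= /right_vertex split_rshift. Qed.

(** [rho1 \o phi2] kills every variable and keeps constants, so it kills the binomials and the ideal
    they generate. *)
Let rho1_phi2 f : f \in binomial_edge_ideal K (complete_graph q) -> rho1 (phi2 f) = 0.
Proof.
move: f; apply: bei_ind => [|f g|c u v _]; first by rewrite !rmorph0.
  by rewrite !rmorphD /= => -> ->; rewrite addr0.
rewrite !rmorphM /= vsubst_binom vsubst_binom /left_vertex.
by rewrite split_rshift mulr0.
Qed.

Let rho2_phi1 f : f \in binomial_edge_ideal K (complete_graph p) -> rho2 (phi1 f) = 0.
Proof.
move: f; apply: bei_ind => [|f g|c u v _]; first by rewrite !rmorph0.
  by rewrite !rmorphD /= => -> ->; rewrite addr0.
rewrite !rmorphM /= vsubst_binom vsubst_binom /right_vertex.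
by rewrite split_lshift mulr0.
Qed.

Let decomposition f : f \in binomial_edge_ideal K (complete_graph (p + q)) ->
  f - phi1 (rho1 f) - phi2 (rho2 f) \in binomial_edge_ideal K G.
Proof.
have G_submod := @bei_submod K _ G.
move: f; apply: bei_ind => [|f g|c u v _].
- by rewrite !rmorph0 !subr0; apply: submod0.
- move=> fI gI; rewrite !rmorphD /= !opprD [f + g + _]addrACA [X in X \in _]addrACA.
  exact: (submodD G_submod fI gI).
rewrite !rmorphM /= !vsubst_binom /left_vertex /right_vertex.
rewrite -(splitK u) -(splitK v).
have join_lr i j : G (lshift q i) (rshift p j).
  by rewrite /= /join_edge split_lshift split_rshift.
(* If u and v are on the same side, one projection keeps f_uv and [bei_cone] applies. If not, both
   projections kill f_uv, which is a generator of J_G. *)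
case: (split u) (split v) => [i|i] [j|j] /=;
  rewrite ?split_lshift ?split_rshift ?rmorph0 ?mulr0 ?subr0.
- rewrite vsubst_binom -mulrBl; apply: bei_cone => [w a|w a].
    by case: splitP => // b wb [<-]; apply: val_inj.
  by case: splitP => // b wb _; rewrite edge_sym (_ : w = rshift p b) //; apply: val_inj.
- exact/ideal_genM/bei_binom.
- by apply/ideal_genM/bei_binom; rewrite edge_sym.
- rewrite vsubst_binom -mulrBl; apply: bei_cone => [w a|w a].
    by case: splitP => // b wb [<-]; apply: val_inj.
  by case: splitP => // b wb _; rewrite (_ : w = lshift q b) //; apply: val_inj.
Qed.

(** Each of G, H, H' contributes the dimension of its ideal's quotient J_(K_n)/J in degree k, and
    the one for G is the sum of the other two. The terms are arranged to avoid subtraction in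
    [nat]. *)
Lemma hilbert_function_join k :
  (hilbert_function (binomial_edge_ideal K G) k
    + hilbert_function (binomial_edge_ideal K (complete_graph p)) k
    + hilbert_function (binomial_edge_ideal K (complete_graph q)) k
  = hilbert_function (binomial_edge_ideal K H) k
    + hilbert_function (binomial_edge_ideal K H') k
    + hilbert_function (binomial_edge_ideal K (complete_graph (p + q))) k)%N.
Proof.
have rel_basis n (Q : sgraph n) : exists d (b : 'I_d -> {mpoly K[n + n]}),
    basis_mod [predI degree_part k & binomial_edge_ideal K (complete_graph n)]
      (binomial_edge_ideal K Q) b.
  have [b bP] := hilbert_functionP k (@bei_submod K _ Q).
  apply: (@basis_mod_sub _ _ _ (@bei_submod _ _ _) _ (degree_part k) _ b) => //.
    exact: predI_submod (@degree_part_submod _ _ _) (@bei_submod _ _ _).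
  by move=> f /andP[].
have add n (Q : sgraph n) (T : finType) (b : T -> {mpoly K[n + n]}) :
    basis_mod [predI degree_part k & binomial_edge_ideal K (complete_graph n)]
      (binomial_edge_ideal K Q) b ->
    (hilbert_function (binomial_edge_ideal K Q) k
      = #|T| + hilbert_function (binomial_edge_ideal K (complete_graph n)) k)%N.
  move=> bP; have [c cP] := hilbert_functionP k (@bei_submod K _ (complete_graph n)).
  rewrite -[hilbert_function (binomial_edge_ideal K (complete_graph n)) k]card_ord -card_sum.
  apply: hilbert_function_basis.
    exact: bei_submod.
  apply: (basis_mod_cat _ _ _ bP cP).
  - exact: degree_part_submod.
  - exact: bei_submod.
  - exact: bei_complete.
have [d1 [b1 b1P]] := rel_basis _ H; have [d2 [b2 b2P]] := rel_basis _ H'.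
have complete_submod n : submod_closed
    [predI degree_part k & binomial_edge_ideal K (complete_graph n)].
  exact: predI_submod (@degree_part_submod _ _ _) (@bei_submod _ _ _).
(* Injectivity where [s] is defined keeps distinct vertices distinct, that is, preserves edges of
   complete graphs. *)
have complete_subst m n (s : 'I_m -> option 'I_n) f :
    (forall u v i, s u = Some i -> s v = Some i -> u = v) ->
    f \in [predI degree_part k & binomial_edge_ideal K (complete_graph m)] ->
  vsubst s f \in [predI degree_part k & binomial_edge_ideal K (complete_graph n)].
  move=> s_inj /andP[fk fI]; apply/andP; split; first exact: vsubst_degree_part.
  apply: vsubst_bei fI => u v i j su sv; apply: contraNneq => ij.
  by apply/eqP/s_inj; [exact: su | rewrite ij].
have phi1_inj u v i : (Some \o @lshift p q) u = Some i ->
    (Some \o @lshift p q) v = Some i -> u = v.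
  by move=> /= <- /Some_inj/lshift_inj.
have phi2_inj u v i : (Some \o @rshift p q) u = Some i ->
    (Some \o @rshift p q) v = Some i -> u = v.
  by move=> /= <- /Some_inj/rshift_inj.
have bP := @basis_mod_sum _ _ _ _ _ _
    [predI degree_part k & binomial_edge_ideal K (complete_graph (p + q))]
    (binomial_edge_ideal K G) _ _ _ _ phi1 phi2 _ _ (@bei_submod _ _ _)
    (complete_submod p) (complete_submod q) phi1_bei phi2_bei
    (fun f => @complete_subst _ _ _ f phi1_inj) (fun f => @complete_subst _ _ _ f phi2_inj)
    _ _ b1P b2P.
(* Surjectivity and injectivity for [bP] are left as the last two goals. *)
rewrite (add _ _ _ _ b1P) (add _ _ _ _ b2P) (add _ _ _ _ (bP _ _)).
- rewrite card_sum !card_ord; lia.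
- move=> f fJ; exists (rho1 f), (rho2 f); split.
  + apply: complete_subst fJ => u v i; rewrite /left_vertex.
    by case: splitP => // a ua [<-]; case: splitP => // b vb [ba];
      apply: val_inj; rewrite /= ua vb ba.
  + apply: complete_subst fJ => u v i; rewrite /right_vertex.
    by case: splitP => // a ua [<-]; case: splitP => // b vb [ba];
      apply: val_inj; rewrite /= ua vb ba.
  + by apply: decomposition; case/andP: fJ.
move=> f1 f2 /andP[_ f1J] /andP[_ f2J] fG; split.
  (* Applying [rho1] to the sum recovers [f1], since the other summand is killed. *)
  by rewrite -(phi1K f1) -[rho1 _]addr0 -(rho1_phi2 f2J) -rmorphD; apply: rho1_bei.
by rewrite -(phi2K f2) -[rho2 _]add0r -(rho2_phi1 f1J) -rmorphD; apply: rho2_bei.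
Qed.

End Join.

(** * Complete graphs *)

Section CompleteHilbert.
Variables (K : fieldType) (n : nat).
Local Notation J := (binomial_edge_ideal K (complete_graph n)).

(** Monomials are written as words of marked indices, with [true] marking a y, so that markers and
    indices can be permuted separately. *)
Definition letter (a : bool * 'I_n) : {mpoly K[n + n]} :=
  if a.1 then vary K a.2 else varx K a.2.

Definition wprod (s : seq (bool * 'I_n)) := \prod_(a <- s) letter a.

Let J_submod : submod_closed J := @bei_submod _ _ _.

(** Exchanging the markers of two letters changes the product by 0 or by plus or minus f_ij. *)
Lemma letter_swap b c i j :
  letter (c, i) * letter (b, j) - letter (b, i) * letter (c, j) \in J.
Proof.
have [-> | neq_ij] := eqVneq i j.
  by rewrite mulrC subrr; apply: submod0.
have binJ u v : u != v -> binom K u v \in J by move=> uv; apply: bei_binom.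
case: b c => [] []; rewrite /letter /= ?subrr; try exact: submod0.
  by rewrite [X in _ - X]mulrC; apply: binJ.
by rewrite mulrC; apply: binJ; rewrite eq_sym.
Qed.

Lemma perm_wprod s t : perm_eq s t -> wprod s = wprod t.
Proof. exact: perm_big. Qed.

(** Modulo J, a product of letters only depends on how many of them are y's and
    on the multiset of their indices. *)
Lemma wprod_congr s t :
    perm_eq (unzip1 s) (unzip1 t) -> perm_eq (unzip2 s) (unzip2 t) ->
  wprod s - wprod t \in J.
Proof.
elim: s t => [|[b i] s IHs] t /= st1 st2.
  case: t st1 st2 => [|a t] /perm_size //= _ _.
  by rewrite subrr; apply: submod0.
(* The induction matches the first letter (b, i) of [s]: some letter of [t] has index i, with a
   marker c that may differ from b. *)
have /mapP[[c i'] cit /= def_i] : i \in unzip2 t by rewrite -(perm_mem st2) mem_head.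
rewrite -{i'}def_i in cit.
have [t1 tE] : exists t1, perm_eq t ((c, i) :: t1).
  by exists (rem (c, i) t); apply: perm_to_rem.
have {}st1 := perm_trans st1 (perm_map fst tE).
have {}st2 := perm_trans st2 (perm_map snd tE).
rewrite (perm_wprod tE) /wprod !big_cons -!/(wprod _).
move: st2; rewrite /= perm_cons => st2.
have [eq_bc | neq_bc] := eqVneq b c.
  move: st1; rewrite /= -eq_bc perm_cons => st1.
  by rewrite -mulrBr; apply/ideal_genM/IHs.
(* For b different from c, another letter (b, j) of [t] carries the wanted marker; swapping markers
   with (c, i) makes (b, i) available. *)
have /mapP[[b' j] bjt /= def_b] : b \in unzip1 t1.
  by have := mem_head b (unzip1 s); rewrite (perm_mem st1) inE (negPf neq_bc).
rewrite -{b'}def_b in bjt.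
have [t2 t1E] : exists t2, perm_eq t1 ((b, j) :: t2).
  by exists (rem (b, j) t1); apply: perm_to_rem.
have {}st2 := perm_trans st2 (perm_map snd t1E).
have st1' : perm_eq (unzip1 s) (c :: unzip1 t2).
  rewrite -(perm_cons b); apply: (perm_trans st1).
  apply: (@perm_trans _ (c :: b :: unzip1 t2)).
    by rewrite perm_cons; apply: (perm_map fst t1E).
  by rewrite (perm_catCA [:: c] [:: b]).
rewrite (perm_wprod t1E) /wprod big_cons -!/(wprod _).
have -> : letter (b, i) * wprod s - letter (c, i) * (letter (b, j) * wprod t2)
  = letter (b, i) * (wprod s - wprod ((c, j) :: t2))
    - wprod t2 * (letter (c, i) * letter (b, j) - letter (b, i) * letter (c, j)).
  by rewrite [wprod (_ :: _)]big_cons -/(wprod _); ring.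
by apply: (submodB J_submod); apply: ideal_genM; [apply: IHs | apply: letter_swap].
Qed.

(** x_i |-> z_i and y_i |-> z_i T, where T is the variable of the outer [{poly _}]. *)
Definition segre : {mpoly K[n + n]} -> {poly {mpoly K[n]}} :=
  mmap (polyC \o @mpolyC n K)
    (fun w => match split w with inl i => ('X_i)%:P | inr i => ('X_i)%:P * 'X end).

HB.instance Definition _ := GRing.RMorphism.on segre.

Lemma segre_letter a : segre (letter a) = ('X_(a.2))%:P * 'X ^+ a.1.
Proof.
rewrite /letter; case: a => [[] i] /=.
  by rewrite /segre mmapX mmap1U (unsplitK (inr i)) expr1.
by rewrite /segre mmapX mmap1U (unsplitK (inl i)) expr0 mulr1.
Qed.

Lemma segre_bei f : f \in J -> segre f = 0.
Proof.
move: f; apply: bei_ind => [|f g|c u v _]; first by rewrite rmorph0.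
  by rewrite rmorphD /= => -> ->; rewrite addr0.
rewrite rmorphM rmorphB !rmorphM /=.
rewrite (segre_letter (true, v)) (segre_letter (true, u)).
rewrite (segre_letter (false, v)) (segre_letter (false, u)) /=.
by ring.
Qed.

Definition mnm_word (s : seq 'I_n) : 'X_{1..n} := (\sum_(i <- s) U_(i))%MM.

Lemma mnm_wordE s j : mnm_word s j = count_mem j s.
Proof.
rewrite /mnm_word mnm_sumE -sum1_count [RHS]big_mkcond; apply: eq_bigr => i _.
by rewrite mnm1E /=; case: (i == j).
Qed.

Lemma mnm_word_perm s t : mnm_word s = mnm_word t -> perm_eq s t.
Proof.
by move=> st; apply/allP => i _ /=; rewrite -!mnm_wordE st.
Qed.

(** The image records exactly the two invariants of [wprod_congr]: the multiset of indices as a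
    monomial in z, and the number of y's as the exponent of T. *)
Lemma segre_wprod s :
  segre (wprod s) = ('X_[mnm_word (unzip2 s)])%:P * 'X ^+ (count id (unzip1 s)).
Proof.
rewrite /wprod rmorph_prod /=; elim: s => [|a s IHs].
  by rewrite /mnm_word !big_nil mpolyX0 mulr1.
rewrite /mnm_word !big_cons IHs segre_letter /= mpolyXD rmorphM exprD /=.
by ring.
Qed.

Lemma mpolyX_wprod (mo : 'X_{1..n + n}) :
  exists2 s, 'X_[mo] = wprod s & size s = mdeg mo.
Proof.
rewrite mdegE mpolyXE_id; elim: (index_enum _) => [|w r [s Es sizes]].
  by exists [::]; rewrite /wprod !big_nil.
pose a := match split w with inl i => (false, i) | inr i => (true, i) end.
exists (nseq (mo w) a ++ s); last by rewrite big_cons size_cat size_nseq sizes.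
rewrite big_cons Es /wprod big_cat big_nseq iter_mulr_1 /=.
suff -> : 'X_w = letter a by [].
by rewrite -(splitK w) /a; case: (split w).
Qed.

Lemma letter_dhomog a : letter a \is 1.-homog.
Proof.
by rewrite /letter; case: a.1; rewrite dhomogX; apply/eqP; apply: mdeg1.
Qed.

Lemma wprod_dhomog s : wprod s \is (size s).-homog.
Proof.
elim: s => [|a s IHs]; first by rewrite /wprod big_nil dhomog1.
rewrite /wprod big_cons -[size _]/(1 + size s)%N.
exact: dhomogM (letter_dhomog a) IHs.
Qed.

End CompleteHilbert.

(** * Normal-form monomials modulo the ideal of a complete graph *)

Section CompleteBasis.
Variables (K : fieldType) (n k : nat).
Local Notation J := (binomial_edge_ideal K (complete_graph n.+1)).

(** Sorted tuples represent the multisets of k vertices; with n + 1 vertices there are C(k+n, k) of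
    them. *)
Let sorted_words := [set t : k.-tuple 'I_n.+1 | sorted leq (map val t)].
Let sorted_word := {t | t \in sorted_words}.

Let bits (a : nat) := nseq a true ++ nseq (k - a) false.

Let size_bits (a : 'I_k.+1) : size (bits a) = k.
Proof. by rewrite size_cat !size_nseq subnKC // -ltnS. Qed.

(** The normal form with given invariants: indices sorted, and the y's on the first [x.1]
    letters. *)
Definition segre_word (x : 'I_k.+1 * sorted_word) : seq (bool * 'I_n.+1) :=
  zip (bits x.1) (val x.2).

Let unzip1_word x : unzip1 (segre_word x) = bits x.1.
Proof. by rewrite unzip1_zip // size_bits size_tuple. Qed.

Let unzip2_word x : unzip2 (segre_word x) = val x.2.
Proof. by rewrite unzip2_zip // size_bits size_tuple. Qed.

Let leq_val_total : total (fun i j : 'I_n.+1 => (i <= j)%N).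
Proof. by move=> i j; apply: leq_total. Qed.

Let sorted_word_of (s : seq 'I_n.+1) : size s = k ->
  exists t : sorted_word, perm_eq s (val t).
Proof.
move=> sizes; pose t := sort (fun i j : 'I_n.+1 => (i <= j)%N) s.
have sizet : size t == k by rewrite size_sort sizes.
have tP : Tuple sizet \in sorted_words.
  by rewrite inE sorted_map; apply: (sort_sorted leq_val_total).
by exists (exist (fun u => u \in sorted_words) _ tP); rewrite perm_sym perm_sort.
Qed.

Let sorted_word_inj (t t' : sorted_word) : perm_eq (val t) (val t') -> t = t'.
Proof.
move=> tt'; apply/val_inj/val_inj; apply: (@sorted_eq _ (fun i j : 'I_n.+1 => (i <= j)%N)) tt'.
- by move=> i j l; apply: leq_trans.
- by move=> i j /anti_leq /val_inj.
- by have := valP t; rewrite inE sorted_map.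
- by have := valP t'; rewrite inE sorted_map.
Qed.

(** Spanning: by [wprod_congr] each monomial is congruent to the normal form with the same
    invariants. Independence: [segre] kills J and sends normal forms to distinct monomials. *)
Lemma segre_basis : basis_mod (degree_part k) J (fun x => wprod K (segre_word x)).
Proof.
have J_submod := @bei_submod K _ (complete_graph n.+1).
split.
- move=> x; rewrite unfold_in; have := wprod_dhomog K (segre_word x).
  by rewrite -(size_map snd) -/(unzip2 _) unzip2_word size_tuple.
- move=> f fk; rewrite [f]mpolyE big_seq.
  pose Q g := exists c, g - \sum_x c x *: wprod K (segre_word x) \in J.
  have QD g h : Q g -> Q h -> Q (g + h).
    move=> [c cJ] [d dJ]; exists (fun x => c x + d x).
    under eq_bigr do rewrite scalerDl.
    by rewrite big_split opprD addrACA; apply: (submodD J_submod).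
  have QZ a g : Q g -> Q (a *: g).
    move=> [c cJ]; exists (fun x => a * c x).
    under eq_bigr do rewrite -scalerA.
    by rewrite -scaler_sumr -scalerBr; apply: (submodZ J_submod).
  apply: (big_ind Q) => [|//|mo mo_f].
    exists (fun=> 0); under eq_bigr do rewrite scale0r.
    by rewrite big1 // subr0; apply: (submod0 J_submod).
  apply: QZ; have [s -> sizes] := mpolyX_wprod K mo.
  have {}sizes : size s = k by rewrite sizes; apply: (dhomog_mf fk mo_f).
  have [t st] : exists t : sorted_word, perm_eq (unzip2 s) (val t).
    by apply: sorted_word_of; rewrite size_map.
  have lt_a : (count id (unzip1 s) < k.+1)%N.
    by rewrite ltnS -sizes -(size_map fst) count_size.
  exists (fun x => (x == (Ordinal lt_a, t))%:R).
  rewrite (bigD1 (Ordinal lt_a, t)) //= eqxx scale1r big1 ?addr0 => [|x /negPf->]; last first.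
    by rewrite scale0r.
  apply: wprod_congr; last by rewrite unzip2_word.
  rewrite unzip1_word /bits /= -[in (k - _)%N]sizes -(size_map fst) -/(unzip1 s).
  apply/allP => b _ /=; rewrite count_cat !count_nseq /=.
  have := count_predC id (unzip1 s).
  case: b => /=; rewrite ?mul1n ?mul0n ?addn0 ?add0n.
  + by move=> _; apply/eqP/eq_count => -[].
  + by move=> <-; rewrite addKn; apply/eqP/eq_count => -[].
move=> c cJ y; pose m (x : 'I_k.+1 * sorted_word) := mnm_word (val x.2).
(* The coefficient at T^(y.1) z^(m y) isolates the normal form [y]; applied to the image of the
   relation, it returns [c y]. *)
have coef_word x : (segre (wprod K (segre_word x)))`_(y.1)@_(m y) = (x == y)%:R.
  rewrite segre_wprod unzip1_word unzip2_word coefCM coefXn count_cat !count_nseq.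
  rewrite mul1n mul0n addn0; case: eqP => [yx1|yx1].
    rewrite mulr1 mcoeffX -/(m x); congr (_%:R); congr (nat_of_bool _).
    apply/eqP/eqP => [/mnm_word_perm/sorted_word_inj|-> //].
    by case: x y yx1 => [x1 x2] [y1 y2] /= /val_inj -> ->.
  by rewrite mulr0 mcoeff0; case: eqP => // xy; case: yx1; rewrite xy.
have := segre_bei cJ => /(congr1 (fun g : {poly {mpoly K[n.+1]}} => g`_(y.1)@_(m y))).
rewrite coef0 mcoeff0 rmorph_sum coef_sum raddf_sum /= => <-.
rewrite (bigD1 y) //= big1 ?addr0 => [|x /negPf neq_xy].
  by rewrite /segre mmapZ coefCM mcoeffCM -/(segre _) coef_word eqxx mulr1.
by rewrite /segre mmapZ coefCM mcoeffCM -/(segre _) coef_word neq_xy mulr0.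
Qed.

Lemma hilbert_function_complete :
  hilbert_function J k = (k.+1 * 'C(k + n, k))%N.
Proof.
rewrite (hilbert_function_basis (@bei_submod _ _ _) segre_basis).
by rewrite card_prod card_ord card_sig -card_sorted_tuples; congr (_ * _)%N; apply: eq_card.
Qed.

End CompleteBasis.

(** * From Hilbert functions to Hilbert series *)

Lemma hilbert_series_complete (K : fieldType) n : (0 < n)%N ->
  hilbert_series (binomial_edge_ideal K (complete_graph n)) =
    ((n%:R - 1) * fpsX + 1) / (1 - fpsX) ^+ (n + 1).
Proof.
case: n => // n _; rewrite -segre_seriesE.
by apply: fpsP => k /=; rewrite hilbert_function_complete.
Qed.

Lemma hilbert_series_join (K : fieldType) p q (H : sgraph p) (H' : sgraph q) :
  hilbert_series (binomial_edge_ideal K (graph_join H H')) =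
    hilbert_series (binomial_edge_ideal K H)
    + hilbert_series (binomial_edge_ideal K H')
    + hilbert_series (binomial_edge_ideal K (complete_graph (p + q)))
    - hilbert_series (binomial_edge_ideal K (complete_graph p))
    - hilbert_series (binomial_edge_ideal K (complete_graph q)).
Proof. by apply: fpsP => k /=; have := hilbert_function_join K H H' k; lia. Qed.

Theorem theorem4p13 (K : fieldType) (p q : nat) (hp : (1 <= p)%N) (hq : (1 <= q)%N)
    (H : sgraph p) (H' : sgraph q) :
  let t : {fps int} := fpsX in
  hilbert_series (binomial_edge_ideal K (graph_join H H')) =
    hilbert_series (binomial_edge_ideal K H)
    + hilbert_series (binomial_edge_ideal K H')
    + (((p + q)%:R - 1) * t + 1) / (1 - t) ^+ (p + q + 1)
    - ((p%:R - 1) * t + 1) / (1 - t) ^+ (p + 1)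
    - ((q%:R - 1) * t + 1) / (1 - t) ^+ (q + 1).
Proof.
move=> t; rewrite hilbert_series_join.
by rewrite !hilbert_series_complete // addn_gt0 hp.
Qed.
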